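(* For $\gamma_1,\gamma_2\in\overline{\mathbb{Q}}$ the following are equivalent: (1) $X(\mathbb{Q}(\gamma_1,\gamma_2),\gamma_1)=X(\mathbb{Q}(\gamma_1,\gamma_2),\gamma_2)$; (2) $X(L,\gamma_1)=X(L,\gamma_2)$ for every number field $L$; (3) $\sqrt{\mathfrak{D}_{\gamma_1}}=\sqrt{\mathfrak{D}_{\gamma_2}}$; (4) $Y(L,\gamma_1)=Y(L,\gamma_2)$ for every number field $L$; (5) $Y(\mathbb{Q}(\gamma_1,\gamma_2),\gamma_1)=Y(\mathbb{Q}(\gamma_1,\gamma_2),\gamma_2)$.
   Context: All number fields are subfields of $\overline{\mathbb{Q}}$; $\overline{\mathbb{Z}}$ is the ring of algebraic integers and $\mathfrak{D}_\gamma=\{a\in\overline{\mathbb{Z}}: a\gamma\in\overline{\mathbb{Z}}\}$. $X(K,\gamma)$ is the set of nonzero prime ideals $\mathfrak{p}$ of $\mathcal{O}_K$ such that every nonzero prime $\mathfrak{q}$ of $\mathcal{O}_{K(\gamma)}$ with $\mathfrak{q}\cap\mathcal{O}_K=\mathfrak{p}$ satisfies $v_{\mathfrak{q}}(\gamma)<0$; $Y(K,\gamma)$ is the set of nonzero prime ideals $\mathfrak{p}$ of $\mathcal{O}_K$ such that some such $\mathfrak{q}$ satisfies $v_{\mathfrak{q}}(\gamma)<0$. *)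

(* Defs.v *)
(* Qbar is modelled by algC (the algebraic closure of Q). *)
From mathcomp Require Import all_boot all_algebra all_field.
Set Implicit Arguments. Unset Strict Implicit. Unset Printing Implicit Defensive.
Import GRing.Theory Num.Theory.
Local Open Scope ring_scope.

Definition is_subfield (F : algC -> Prop) : Prop :=
  F 0 /\ F 1 /\
  (forall x y, F x -> F y -> F (x + y)) /\
  (forall x, F x -> F (- x)) /\
  (forall x y, F x -> F y -> F (x * y)) /\
  (forall x, F x -> x != 0 -> F x^-1).

Definition number_field (F : algC -> Prop) : Prop :=
  is_subfield F /\
  exists (n : nat) (s : 'I_n -> algC), forall x, F x ->
    exists c : 'I_n -> rat, x = \sum_(i < n) ratr (c i) * s i.

Definition gen_field (S : algC -> Prop) : algC -> Prop :=
  fun x => forall F, is_subfield F -> (forall y, S y -> F y) -> F x.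

Definition adjoin (K : algC -> Prop) (g : algC) : algC -> Prop :=
  gen_field (fun y => K y \/ y = g).

Definition ring_of_integers (K : algC -> Prop) : algC -> Prop :=
  fun x => K x /\ x \in Aint.

Definition nonzero_prime_ideal (R I : algC -> Prop) : Prop :=
  (forall x, I x -> R x) /\
  I 0 /\
  (forall x y, I x -> I y -> I (x + y)) /\
  (forall r x, R r -> I x -> I (r * x)) /\
  (exists x, I x /\ x != 0) /\
  ~ I 1 /\
  (forall a b, R a -> R b -> I (a * b) -> I a \/ I b).

Definition ideal_mul (I J : algC -> Prop) : algC -> Prop :=
  fun x => exists (k : nat) (a b : 'I_k -> algC),
    (forall i, I (a i)) /\ (forall i, J (b i)) /\ x = \sum_(i < k) a i * b i.

Fixpoint ideal_pow (R q : algC -> Prop) (n : nat) : algC -> Prop :=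
  match n with
  | 0 => R
  | n'.+1 => ideal_mul (ideal_pow R q n') q
  end.

(* v_q(g) < 0, for q a nonzero prime of O_M and g in M:
   writing g = a / b with a, b in O_M, b <> 0, we have
   v_q(g) = ord_q(a) - ord_q(b) where ord_q(c) = max {n | c ∈ q^n};
   ord_q(a) < ord_q(b) iff some q^n contains b but not a. *)
Definition val_neg (M q : algC -> Prop) (g : algC) : Prop :=
  exists a b, ring_of_integers M a /\ ring_of_integers M b /\ b != 0 /\
    g = a / b /\
    exists n, ideal_pow (ring_of_integers M) q n b /\
              ~ ideal_pow (ring_of_integers M) q n a.

Definition lies_over (K q p : algC -> Prop) : Prop :=
  forall x, (q x /\ ring_of_integers K x) <-> p x.

Definition in_X (K : algC -> Prop) (g : algC) (p : algC -> Prop) : Prop :=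
  nonzero_prime_ideal (ring_of_integers K) p /\
  forall q, nonzero_prime_ideal (ring_of_integers (adjoin K g)) q ->
    lies_over K q p -> val_neg (adjoin K g) q g.

Definition in_Y (K : algC -> Prop) (g : algC) (p : algC -> Prop) : Prop :=
  nonzero_prime_ideal (ring_of_integers K) p /\
  exists q, [/\ nonzero_prime_ideal (ring_of_integers (adjoin K g)) q,
    lies_over K q p & val_neg (adjoin K g) q g].

Definition X_eq K g1 g2 : Prop := forall p, in_X K g1 p <-> in_X K g2 p.
Definition Y_eq K g1 g2 : Prop := forall p, in_Y K g1 p <-> in_Y K g2 p.

Definition denom_ideal (g : algC) : algC -> Prop :=
  fun a => a \in Aint /\ a * g \in Aint.
Definition radical (I : algC -> Prop) : algC -> Prop :=
  fun a => a \in Aint /\ exists n, (0 < n)%N /\ I (a ^+ n).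

(* Main.v *)
Require Import Defs.
From mathcomp Require Import all_boot all_algebra all_field.
From mathcomp Require Import ring.
From mathcomp Require Import boolp classical_sets.
Set Implicit Arguments. Unset Strict Implicit. Unset Printing Implicit Defensive.
Import GRing.Theory Num.Theory.
Local Open Scope ring_scope.

(* For a prime P of the ring of all algebraic integers, say that g has a pole
   at P when P contains every denominator of g. The ring O_M of a field M is
   a Pruefer domain, so v_q(g) < 0 at a prime q of O_M says exactly that q
   contains every denominator of g in O_M, and this is insensitive to replacing
   M by a larger field and q by a prime above it. By lying over, p is in
   X(K, g) (resp. Y(K, g)) iff g has a pole at all (resp. some) primes above p
   of the ring of algebraic integers; when g is in K, all these primes behave
   alike. By Krull's theorem the radical of the denominator ideal of g is the
   intersection of the primes at which g has a pole. Hence each of the five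
   conditions says that g1 and g2 have the same poles. *)

(** * Algebraic integers and integral equations *)

(** Gives [Aint], which is defined through the minimal polynomial, access to the closure properties
    of integral elements. *)
Lemma Aint_integralOver (x : algC) :
  x \in Aint <-> integralOver (intr : int -> algC) x.
Proof.
split=> [Ax | [p mon_p px0]].
  have [p Dp] := floorpP Ax; exists p; last by rewrite -Dp root_minCpoly.
  have := minCpoly_monic x; rewrite Dp !monicE lead_coef_map_inj //; last exact: intr_inj.
  by rewrite -[1]/(1%:~R) eqr_int.
apply: root_monic_Aint px0 _ _; first exact: monic_map.
by apply/polyOverP=> i; rewrite coef_map /= intr_int.
Qed.

Lemma root_monic_polyOver_Aint (p : {poly algC}) (x : algC) :
  p \is monic -> p \is a polyOver Aint -> root p x -> x \in Aint.
Proof.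
move=> mon_p /polyOverP Ap px0; apply/Aint_integralOver.
apply: integral_root_monic mon_p px0 _; apply/integral_poly => i.
exact/Aint_integralOver.
Qed.

(** For p of degree n + 1 with leading coefficient a, multiplying p(x) = 0 by a^n gives a monic
    equation for a x with coefficients p_i a^(n - i). *)
Lemma lead_coef_mul_Aint (p : {poly algC}) (x : algC) :
  p \is a polyOver Aint -> root p x -> lead_coef p * x \in Aint.
Proof.
move=> Ap px0; set a := lead_coef p.
have [p0 | nz_p] := eqVneq p 0; first by rewrite /a p0 lead_coef0 mul0r Aint0.
case sz_p: (size p) => [|[|n]]; first by rewrite -size_poly_eq0 sz_p in nz_p.
  move: px0; rewrite (size1_polyC (eq_leq sz_p)) rootC => c0.
  by rewrite -size_poly_eq0 (size1_polyC (eq_leq sz_p)) size_polyC c0 in nz_p.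
have Aa: a \in Aint by rewrite /a lead_coefE (polyOverP Ap).
pose h : {poly algC} := 'X^(n.+1) + \poly_(i < n.+1) (p`_i * a ^+ (n - i)).
apply: (@root_monic_polyOver_Aint h).
- by rewrite monicE /h lead_coefDl ?lead_coefXn ?size_polyXn ?ltnS ?size_poly.
- rewrite rpredD ?rpredX ?polyOverX //; apply/polyOverP=> i.
  rewrite coef_poly; case: ifP => _; last exact: rpred0.
  by rewrite rpredM ?rpredX ?(polyOverP Ap).
rewrite /root /h !hornerE horner_poly; move: px0; rewrite /root horner_coef sz_p.
rewrite big_ord_recr /= -[p`_n.+1]/(p`_(n.+2.-1)) -sz_p -lead_coefE -/a => /eqP px0.
apply/eqP; rewrite -[RHS](mulr0 (a ^+ n)) -[X in _ = _ * X]px0.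
rewrite mulrDr addrC mulr_sumr; congr (_ + _).
  apply: eq_bigr => i _; rewrite exprMn.
  have ->: a ^+ n = a ^+ (n - i) * a ^+ i by rewrite -exprD subnK // -ltnS.
  by ring.
by rewrite exprMn exprS; ring.
Qed.

(** * Subrings of the algebraic numbers and their ideals *)

Definition is_subring (R : algC -> Prop) : Prop :=
  [/\ R 1, forall x y, R x -> R y -> R (x - y)
    & forall x y, R x -> R y -> R (x * y)].

Definition is_ideal (R I : algC -> Prop) : Prop :=
  [/\ forall x, I x -> R x, I 0, forall x y, I x -> I y -> I (x + y)
    & forall r x, R r -> I x -> I (r * x)].

Lemma subring0 R : is_subring R -> R 0.
Proof. by case=> R1 RB _; rewrite -(subrr 1); apply: RB. Qed.

Lemma subringN R x : is_subring R -> R x -> R (- x).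
Proof.
move=> SR Rx; rewrite -sub0r; case: (SR) => _ RB _.
by apply: RB => //; apply: subring0.
Qed.

Lemma subringD R x y : is_subring R -> R x -> R y -> R (x + y).
Proof.
move=> SR Rx Ry; rewrite -[y]opprK; case: (SR) => _ RB _.
by apply: RB => //; apply: subringN.
Qed.

Lemma subringX R x n : is_subring R -> R x -> R (x ^+ n).
Proof.
by case=> R1 _ RM Rx; elim: n => // n IHn; rewrite exprS; apply: RM.
Qed.

Lemma subring_int R (m : int) : is_subring R -> R m%:~R.
Proof.
move=> SR; have Rn n : R n%:R.
  elim: n => [|n IHn]; first exact: subring0.
  by rewrite -natr1; apply: subringD => //; case: SR.
by case: m => n; [exact: Rn | rewrite NegzE mulrNz; apply: subringN => //; apply: Rn].
Qed.

Lemma subring_horner_int R (p : {poly int}) x :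
  is_subring R -> R x -> R (map_poly intr p).[x].
Proof.
move=> SR Rx; elim/poly_ind: p => [|p c IHp].
  by rewrite rmorph0 horner0; apply: subring0.
rewrite rmorphD rmorphM /= map_polyX map_polyC !hornerE /=.
by apply: subringD (subring_int _ _) => //; case: SR => _ _; apply.
Qed.

Lemma idealN R I x : is_subring R -> is_ideal R I -> I x -> I (- x).
Proof.
move=> SR [_ _ _ IM] Ix; rewrite -mulN1r; apply: IM => //.
by apply: subringN => //; case: SR.
Qed.

Lemma idealB R I x y : is_subring R -> is_ideal R I -> I x -> I y -> I (x - y).
Proof. by move=> SR Id Ix Iy; case: (Id) => _ _ + _; apply=> //; apply: idealN SR Id Iy. Qed.

(** Up to sign the content is the gcd of the coefficients, hence an integer combination of them by
    Bezout. *)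
Lemma ideal_zcontents R I (p : {poly int}) :
  is_subring R -> is_ideal R I -> (forall i, I (p`_i)%:~R) ->
  I (zcontents p)%:~R.
Proof.
move=> SR Id Ip; have [_ I0 ID IM] := Id.
have Iint (m n : int) : I n%:~R -> I (m * n)%:~R.
  by move=> In; rewrite intrM; apply: IM => //; apply: subring_int.
apply: (Iint).
apply: (big_ind (fun n : nat => I (n%:Z)%:~R)) => // [m n Im In | i _].
  have [u [v Duv]] := Bezoutz m n.
  by rewrite -[X in I X%:~R]/(gcdz m n) -Duv intrD; apply: ID; apply: Iint.
by rewrite abszEsg; apply: Iint.
Qed.

Lemma prime_is_ideal R p : nonzero_prime_ideal R p -> is_ideal R p.
Proof. by case=> ? [? [? [? _]]]; split. Qed.

Lemma primeX R p x n : is_subring R -> nonzero_prime_ideal R p ->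
  R x -> p (x ^+ n) -> p x.
Proof.
move=> SR [_ [_ [_ [_ [_ [n1 pM]]]]]] Rx; elim: n => [|n IHn]; first by [].
by rewrite exprS => /pM[] //; apply: subringX.
Qed.

Lemma ring_of_integers_subring M : is_subfield M -> is_subring (ring_of_integers M).
Proof.
case=> _ [M1 [MD [MN [MM _]]]]; split.
- by split=> //; apply: Aint1.
- by move=> x y [Mx Ax] [My Ay]; split; rewrite ?rpredB //; apply/MD/MN.
by move=> x y [Mx Ax] [My Ay]; split; rewrite ?rpredM //; apply/MM.
Qed.

Lemma is_subfieldT : is_subfield (fun=> True).
Proof. by []. Qed.

(** * The Pruefer property of rings of integers *)

(* Synthetic division by X - g: the leading coefficient a and a * g are both
   integral, so a * g may be carried over to the next coefficient and the
   degree drops. *)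
Lemma root_coef_ideal M q g (p : {poly algC}) :
  is_subfield M -> M g -> is_ideal (ring_of_integers M) q ->
  (forall s, ring_of_integers M s -> ring_of_integers M (s * g) ->
     q s /\ q (s * g)) ->
  (forall i, ring_of_integers M p`_i) -> root p g -> forall i, q p`_i.
Proof.
move=> SM Mg Id qden.
have SR := ring_of_integers_subring SM; have R0 := subring0 SR.
have [qR q0 qD qM] := Id.
have [_ [_ [MD [_ [MM _]]]]] := SM.
have [n] := ubnP (size p); elim: n p => // n IHn p; rewrite ltnS => sz_p Rp pg0.
move: sz_p; rewrite leq_eqVlt => /orP[/eqP sz_p | sz_p]; last exact: IHn.
have pAint : p \is a polyOver Aint by apply/polyOverP=> i; case: (Rp i).
case: n IHn sz_p => [|n] IHn sz_p.
  by move=> i; rewrite (size0nil sz_p) nth_nil.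
case: n IHn sz_p => [|n] IHn sz_p.
  move: pg0; rewrite (size1_polyC (eq_leq sz_p)) rootC => /eqP-> i.
  by rewrite coefC if_same.
set a := p`_n.+1.
have Ra : ring_of_integers M a by apply: Rp.
have Rag : ring_of_integers M (a * g).
  split; first by apply: MM => //; case: Ra.
  by have := lead_coef_mul_Aint pAint pg0; rewrite lead_coefE sz_p.
have [qa qag] := qden a Ra Rag.
pose r := p - a%:P * ('X - g%:P) * 'X^n.
have Dr i : r`_i = p`_i - (if (i == n.+1) then a else 0) +
                          (if (i == n) then a * g else 0).
  rewrite coefB mulrBr mulrBl coefB -polyCM -!mulrA -exprS !coefCM !coefXn.
  rewrite ?mulrA ?mulrb.
  by do 2!case: (_ == _); rewrite ?mulr1 ?mulr0 ?mulr1n ?mulr0n; ring.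
have qr i : q r`_i.
  apply: IHn.
  - apply/leq_sizeP=> j; rewrite Dr leq_eqVlt => /orP[/eqP<- | lt_n_j].
      by rewrite eqxx gtn_eqF // subrr addr0.
    by rewrite !gtn_eqF // 1?ltnW // subr0 addr0 nth_default ?sz_p.
  - move=> j; rewrite Dr; apply: subringD => //.
      by case: (SR) => _ RB _; apply: RB => //; case: ifP.
    by case: ifP.
  by rewrite /root !hornerE (rootP pg0) subrr mulr0 mul0r subr0.
move=> i; have -> : p`_i = r`_i + (if i == n.+1 then a else 0)
                         - (if i == n then a * g else 0) by rewrite Dr; ring.
by apply: idealB (SR) Id _ _; [apply: qD => // |]; case: ifP.
Qed.

(** Clear the denominators of the minimal polynomial and divide by the content. An ideal containing
    all coefficients of such a polynomial contains 1. *)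
Lemma root_primitive (g : algC) :
  exists2 p : {poly int}, zcontents p = 1 & root (map_poly intr p) g.
Proof.
have [p [Dp mon_p _]] := minCpolyP g.
have [q [d nz_d Dq]] := rat_poly_scale p.
have pg0 : root (map_poly intr q : {poly algC}) g.
  have := root_minCpoly g; rewrite Dp Dq map_polyZ /= rootZ.
    by rewrite -map_poly_comp (eq_map_poly (fun m => ratr_int _ m)).
  by rewrite fmorph_eq0 invr_eq0 intr_eq0.
have nz_q : q != 0.
  apply: contraTneq mon_p => q0.
  by rewrite Dq q0 rmorph0 scaler0 monicE lead_coef0 eq_sym oner_eq0.
exists (zprimitive q); first by rewrite zcontents_primitive nz_q.
move: pg0; rewrite {1}[q]zpolyEprim map_polyZ /= rootZ //.
by rewrite intr_eq0 zcontents_eq0.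
Qed.

(* Pruefer property: if q is prime, g or its inverse lies in the localization
   of O_M at q. *)
Lemma ring_of_integers_valuation M q g :
  is_subfield M -> M g -> is_ideal (ring_of_integers M) q -> ~ q 1 ->
  exists s, [/\ ring_of_integers M s, ring_of_integers M (s * g)
               & ~ (q s /\ q (s * g))].
Proof.
(* If there were no such s, q would contain all coefficients of a primitive polynomial vanishing at
   g, hence its content 1. *)
move=> SM Mg Id q1; apply: contrapT => no_s; apply: q1.
have [p p1 pg0] := root_primitive g.
have SR := ring_of_integers_subring SM.
have <- : (zcontents p)%:~R = 1 :> algC by rewrite p1.
apply: (ideal_zcontents SR Id) => i.
rewrite -coef_map; apply: (root_coef_ideal SM Mg Id _ _ pg0) => [s Rs Rsg | j].
  by apply: contrapT => nq; apply: no_s; exists s.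
by rewrite coef_map; apply: subring_int.
Qed.

(** * Maximality of nonzero primes *)

(** Once the factors X are divided out of p, its nonzero constant term is a multiple of x. *)
Lemma ideal_root_int R I (p : {poly int}) x :
  is_subring R -> is_ideal R I -> I x -> x != 0 -> p != 0 ->
  root (map_poly intr p) x -> exists2 m : int, m != 0 & I m%:~R.
Proof.
move=> SR Id Ix nz_x; elim/poly_ind: p => [|p c IHp]; first by rewrite eqxx.
have Rx : R x by case: Id => + _ _ _; apply.
rewrite /root rmorphD rmorphM /= map_polyX map_polyC !hornerE /= => nz_pc pcx0.
have [c0 | nz_c] := eqVneq c 0.
  move: nz_pc pcx0; rewrite c0 polyC0 !addr0 !mulf_eq0 polyX_eq0 (negPf nz_x) !orbF.
  exact: IHp.
exists c => //; move: pcx0; rewrite addr_eq0 -eqr_oppLR => /eqP<-.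
apply: (idealN SR Id); case: (Id) => _ _ _; apply=> //.
exact: subring_horner_int.
Qed.

Lemma Aint_ideal_int M I x :
  is_subfield M -> is_ideal (ring_of_integers M) I -> I x -> x != 0 ->
  exists2 m : int, m != 0 & I m%:~R.
Proof.
move=> SM Id Ix nz_x; have [p p1 px0] := root_primitive x.
apply: (ideal_root_int (ring_of_integers_subring SM) Id Ix nz_x _ px0).
by apply/eqP=> p0; move: p1; rewrite p0 zcontents0.
Qed.

(** Induction on |m|. The gcd d of c and m is not in p, so m / d is. Either d = 1 and Bezout gives
    u, or m / d is smaller than m. *)
Lemma prime_int_comaximal R p (m c : int) :
  is_subring R -> nonzero_prime_ideal R p -> m != 0 -> p m%:~R ->
  ~ p c%:~R -> exists u : int, p (1 - (u * c)%:~R).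
Proof.
move=> SR Pp; have Id := prime_is_ideal Pp; have [_ p0 _ pM] := Id.
have pintr (k l : int) : p l%:~R -> p (k * l)%:~R.
  by move=> pl; rewrite intrM; apply: pM => //; apply: subring_int.
have [n] := ubnP `|m|%N; elim: n m => // n IHn m; rewrite ltnS => le_m nz_m pm npc.
have [u [v Duv]] := Bezoutz c m.
have /dvdzP[m' Dm] := dvdz_gcdr c m; have /dvdzP[c' Dc] := dvdz_gcdl c m.
have npd : ~ p (gcdz c m)%:~R.
  by move=> pd; apply: npc; rewrite Dc; apply: pintr.
have pm' : p m'%:~R.
  have : p (m'%:~R * (gcdz c m)%:~R) by rewrite -intrM -Dm.
  by case: Pp => _ [_ [_ [_ [_ [_ pr]]]]] /pr[] //; apply: subring_int.
have nz_m' : m' != 0 by apply: contraNneq nz_m => m'0; rewrite Dm m'0 mul0r.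
have [d1 | d_neq1] := eqVneq `|gcdz c m|%N 1%N.
  exists u; rewrite -[1]/(1%:~R) -intrB.
  have -> : 1 - u * c = v * m.
    by rewrite -(congr1 Posz d1 : gcdz c m = 1) -Duv; ring.
  exact: pintr.
apply: (IHn m') => //; apply: leq_trans le_m.
rewrite [in X in (_ < X)%N]Dm abszM ltn_Pmulr ?absz_gt0 //.
rewrite ltn_neqAle eq_sym d_neq1 absz_gt0 gcdz_eq0 negb_and nz_m orbT //.
Qed.

(** An inverse of s modulo p is read off a monic integral equation of s: constant terms in p are
    dropped and s is cancelled, until a constant term c outside p appears, which is invertible
    modulo p. *)
Lemma ring_of_integers_comaximal M p s :
  is_subfield M -> nonzero_prime_ideal (ring_of_integers M) p ->
  ring_of_integers M s -> ~ p s ->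
  exists2 t, ring_of_integers M t & p (1 - s * t).
Proof.
move=> SM Pp Rs nps; have SR := ring_of_integers_subring SM.
have Id := prime_is_ideal Pp; have [_ p0 pD pM] := Id.
have [_ [_ [_ [_ [[x [px nz_x]] [np1 pr]]]]]] := Pp.
have [m nz_m pm] := Aint_ideal_int SM Id px nz_x.
have [f mon_f fs0] : integralOver intr s by apply/Aint_integralOver; case: Rs.
(* The equation is weakened to a congruence f(s) = 0 modulo p, which survives the cancellation of
   s. *)
have : p (map_poly intr f).[s] by rewrite (rootP fs0).
move: mon_f {fs0}; elim/poly_ind: f => [|f c IHf].
  by rewrite monicE lead_coef0 eq_sym oner_eq0.
have Rfs := subring_horner_int f SR Rs.
rewrite monicE rmorphD rmorphM /= map_polyX map_polyC !hornerE /=.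
have [-> | nz_f] := eqVneq f 0.
  by rewrite mul0r add0r lead_coefC rmorph0 horner0 mul0r add0r => /eqP->.
rewrite lead_coefDl ?lead_coefMX; last first.
  rewrite size_mulX // size_polyC ltnS; apply: leq_trans (leq_b1 _) _.
  by rewrite size_poly_gt0.
rewrite -monicE => mon_f pfs.
have [pc | npc] := pselect (p c%:~R).
  have [] // := pr _ _ Rfs Rs; last exact: IHf.
  by rewrite -[X in p X](addrK c%:~R); apply: idealB SR Id _ _.
have [u pu] := prime_int_comaximal SR Pp nz_m pm npc.
exists (- (u%:~R * (map_poly intr f).[s])).
  apply: subringN => //; case: (SR) => _ _; apply=> //; exact: subring_int.
have -> : 1 - s * - (u%:~R * (map_poly intr f).[s]) =
   1 - (u * c)%:~R + u%:~R * ((map_poly intr f).[s] * s + c%:~R).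
  by rewrite intrM; ring.
by apply: pD => //; apply: pM => //; apply: subring_int.
Qed.

(** * Powers of ideals, negative valuation and poles *)

Lemma ideal_mul_ideal R I J : is_ideal R I -> is_ideal R J ->
  is_subring R -> is_ideal R (ideal_mul I J).
Proof.
move=> [IR I0 ID IM] [JR J0 JD JM] SR; have [_ _ RM] := SR; split.
- move=> _ [k [a [b [Ia [Jb ->]]]]]; elim/big_ind: _ => [|x y|i _].
  + exact: subring0.
  + exact: subringD.
  + by apply: (RM); [apply: (IR) | apply: (JR)].
- by exists 0%N, (fun=> 0), (fun=> 0); split=> // ; split=> //; rewrite big_ord0.
- move=> _ _ [k [a [b [Ia [Jb ->]]]]] [l [c [d [Ic [Jd ->]]]]].
  pose glue (f : 'I_k -> algC) (g : 'I_l -> algC) i :=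
    match split i with inl j => f j | inr j => g j end.
  exists (k + l)%N, (glue a c), (glue b d); split; last split.
  + by move=> i; rewrite /glue; case: split.
  + by move=> i; rewrite /glue; case: split.
  rewrite big_split_ord /=; congr (_ + _); apply: eq_bigr => i _; rewrite /glue.
    by rewrite (unsplitK (inl i : 'I_k + 'I_l)).
  by rewrite (unsplitK (inr i : 'I_k + 'I_l)).
move=> r _ Rr [k [a [b [Ia [Jb ->]]]]].
exists k, (fun i => r * a i), b; split; first by move=> i; apply: (IM).
by split=> //; rewrite mulr_sumr; apply: eq_bigr => i _; rewrite mulrA.
Qed.

Lemma ideal_mulr_sub R I J x : is_ideal R J -> (forall y, I y -> R y) ->
  ideal_mul I J x -> J x.
Proof.
move=> [_ J0 JD JM] IR [k [a [b [Ia [Jb ->]]]]].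
by elim/big_ind: _ => // i _; apply: (JM) => //; apply: (IR).
Qed.

Lemma ideal_pow_ideal R q n : is_subring R -> is_ideal R q ->
  is_ideal R (ideal_pow R q n).
Proof.
move=> SR Iq; elim: n => [|n IHn] /=; last exact: ideal_mul_ideal.
by split=> //; [apply: subring0 | move=> x y; apply: subringD | case: SR].
Qed.

Lemma ideal_pow_comaximal R q n s : is_subring R -> is_ideal R q ->
  R s -> (exists2 t, R t & q (1 - s * t)) ->
  exists2 t, R t & ideal_pow R q n (1 - s * t).
Proof.
move=> SR Iq Rs [t1 Rt1 qt1]; have [_ RB RM] := SR.
elim: n => [|n [t Rt qt]] /=.
  by exists 0; [apply: subring0 | rewrite mulr0 subr0; case: SR].
(* Chosen so that 1 - s times it is the product (1 - s t)(1 - s t1). *)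
exists (t + t1 - s * t * t1).
  by apply: (RB); [apply: subringD | apply: (RM) => //; apply: (RM)].
exists 1%N, (fun=> 1 - s * t), (fun=> 1 - s * t1); split=> //; split=> //.
by rewrite big_ord1; ring.
Qed.

(** Free of powers of [q], so that it can be compared along field extensions. *)
Definition pole (M q : algC -> Prop) (g : algC) : Prop :=
  forall s, ring_of_integers M s -> ring_of_integers M (s * g) -> q s.

(** A denominator s outside q is invertible modulo q^n, so s a = (s g) b would carry b in q^n over
    to a. Conversely, the Pruefer property gives a denominator c such that c and c g are not both in
    q; at a pole c is in q, so g = (c g) / c has negative valuation, seen already at n = 1. *)
Lemma val_neg_pole M q g : is_subfield M -> M g ->
  nonzero_prime_ideal (ring_of_integers M) q -> val_neg M q g <-> pole M q g.
Proof.
move=> SM Mg Pq; have SR := ring_of_integers_subring SM.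
have Iq := prime_is_ideal Pq; have [qR q0 qD qM] := Iq; split.
  move=> [a [b [Ra [Rb [nz_b [Dg [n [qb nqa]]]]]]]] s Rs Rsg.
  apply: contrapT => nqs; apply: nqa.
  have [t Rt qt] := ideal_pow_comaximal n SR Iq Rs
                      (ring_of_integers_comaximal SM Pq Rs nqs).
  have [_ _ ID IM] := ideal_pow_ideal n SR Iq.
  have -> : a = t * (s * g * b) + a * (1 - s * t).
    have -> : a = g * b by rewrite Dg mulfVK.
    by ring.
  by apply: (ID); apply: (IM) => //; apply: (IM).
move=> pole_q; have nq1 : ~ q 1 by case: Pq => _ [_ [_ [_ [_ []]]]].
have [c [Rc Rcg nq]] := ring_of_integers_valuation SM Mg Iq nq1.
have qc := pole_q c Rc Rcg.
have nqcg : ~ q (c * g) by move=> qcg; apply: nq.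
have nz_c : c != 0 by apply/eqP=> c0; apply: nqcg; rewrite c0 mul0r.
exists (c * g), c; do 3!split=> //; split; first by rewrite mulrC mulKf.
exists 1%N; split; last by move/(ideal_mulr_sub Iq)=> /(_ (fun _ => id)).
exists 1%N, (fun=> 1), (fun=> c); split; first by case: SR.
by rewrite big_ord1 mul1r.
Qed.

(** * Contraction of primes and of poles *)

Lemma contraction_prime M N P :
  is_subfield M -> is_subfield N -> (forall x, M x -> N x) ->
  nonzero_prime_ideal (ring_of_integers N) P ->
  nonzero_prime_ideal (ring_of_integers M) (fun x => P x /\ ring_of_integers M x).
Proof.
move=> SM SN MN Pp.
have RMN x : ring_of_integers M x -> ring_of_integers N x.
  by case=> /MN Nx Ax; split.
have SR := ring_of_integers_subring SM; have [R1 _ RM] := SR.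
have IP := prime_is_ideal Pp; have [PR P0 PD PM] := IP.
have [_ [_ [_ [_ [[x [Px nz_x]] [nP1 pr]]]]]] := Pp.
(* A nonzero integer in [P] makes the contraction nonzero. *)
have [m nz_m Pm] := Aint_ideal_int SN IP Px nz_x.
split; first by move=> y [].
split; first by split=> //; apply: subring0.
split; first by move=> y z [Py Ry] [Pz Rz]; split; [apply: (PD) | apply: subringD].
split; first by move=> r y Rr [Py Ry]; split; [apply: (PM) => //; apply: RMN | apply: (RM)].
split.
  exists m%:~R; split; last by rewrite intr_eq0.
  by split=> //; apply: subring_int.
split; first by case.
move=> a b Ra Rb [Pab _].
by have [] := pr _ _ (RMN _ Ra) (RMN _ Rb) Pab; [left | right].
Qed.

(** At a pole q, the Pruefer property in M gives c in q with c g integral and outside P. For a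
    denominator t of g in N, t (c g) = c (t g) is in P, so t is in P. The converse holds since
    denominators in M are denominators in N. *)
Lemma pole_contraction M N q P g :
  is_subfield M -> is_subfield N -> (forall x, M x -> N x) -> M g ->
  nonzero_prime_ideal (ring_of_integers N) P ->
  (forall x, (P x /\ ring_of_integers M x) <-> q x) ->
  pole M q g <-> pole N P g.
Proof.
move=> SM SN MN Mg Pp /(_ _)/propext Dq.
have {q Dq} -> : q = (fun x => P x /\ ring_of_integers M x).
  by apply/funext => x; rewrite -Dq.
have Pq := contraction_prime SM SN MN Pp.
have RMN x : ring_of_integers M x -> ring_of_integers N x.
  by case=> /MN Nx Ax; split.
split; last first.
  by move=> pole_P s Rs Rsg; split=> //; apply: pole_P; apply: RMN.
move=> pole_q t Rt Rtg.
have nq1 : ~ (P 1 /\ ring_of_integers M 1) by case: Pq => _ [_ [_ [_ [_ []]]]].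
have [c [Rc Rcg nq]] := ring_of_integers_valuation SM Mg (prime_is_ideal Pq) nq1.
have qc := pole_q c Rc Rcg.
have nPcg : ~ P (c * g) by move=> Pcg; apply: nq.
have [_ [_ [_ [PM [_ [_ pr]]]]]] := Pp.
have [] // := pr t (c * g) Rt (RMN _ Rcg).
by rewrite mulrCA mulrC; apply: (PM) => //; case: qc.
Qed.

(** * Krull's theorem and lying over *)

(** By Zorn, P is taken maximal among the ideals containing I and disjoint from S. The last clause
    records this maximality, on which lying over depends. *)
Lemma multiplicative_avoiding_prime R I (S : algC -> Prop) :
  is_subring R -> is_ideal R I -> (forall x, S x -> R x) -> S 1 ->
  (forall x y, S x -> S y -> S (x * y)) -> (forall x, I x -> ~ S x) ->
  exists P, [/\ is_ideal R P, forall x, I x -> P x, forall x, P x -> ~ S x,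
    forall a b, R a -> R b -> P (a * b) -> P a \/ P b
    & forall x, R x -> ~ P x -> exists p y, [/\ P p, R y & S (p + y * x)]].
Proof.
move=> SR Id SubR S1 SM IS; have [IR I0 ID IM] := Id; have [R1 RB RM] := SR.
(* The empty chain has union [set0], hence the requirement on [I `|` A]. *)
pose good (A : set algC) :=
  is_ideal R (I `|` A)%classic /\ forall x, A x -> ~ S x.
have chain (F : set (set algC)) : (F `<=` good)%classic -> total_on F subset ->
    good (\bigcup_(X in F) X)%classic.
  move=> Fgood Ftot; split; last by move=> x [X /Fgood[_ XS] /XS].
  have lift X x : F X -> (I `|` X)%classic x -> (I `|` \bigcup_(X in F) X)%classic x.
    by move=> FX [Ix | Xx]; [left | right; exists X].
  split=> [x [/IR // | [X /Fgood[[XR _ _ _] _] Xx]]||x y|r x Rr].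
  - by apply: (XR); right.
  - by left.
  - move=> [Ix | [X FX Xx]] [Iy | [Y FY Yy]].
    + by left; apply: (ID).
    + have [[_ _ YD _] _] := Fgood _ FY.
      by apply: (lift Y) => //; apply: (YD); [left | right].
    + have [[_ _ XD _] _] := Fgood _ FX.
      by apply: (lift X) => //; apply: (XD); [right | left].
    have [[_ _ XD _] _] := Fgood _ FX; have [[_ _ YD _] _] := Fgood _ FY.
    have [XY | YX] := Ftot _ _ FX FY.
      by apply: (lift Y) => //; apply: (YD); right => //; apply: (XY).
    by apply: (lift X) => //; apply: (XD); right => //; apply: (YX).
  move=> [Ix | [X FX Xx]]; first by left; apply: (IM).
  have [[_ _ _ XM] _] := Fgood _ FX.
  by apply: (lift X) => //; apply: (XM) => //; right.
have [A [[IA AS] maxA]] := Zorn_bigcup chain.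
pose P := (I `|` A)%classic; have PS x : P x -> ~ S x by move=> [/IS | /AS].
have [PR P0 PD PM] := IA.
have maxP x : R x -> ~ P x -> exists p y, [/\ P p, R y & S (p + y * x)].
  move=> Rx nPx; apply: contrapT => noS.
  (* The ideal generated by P and x; if it avoided S it would contradict the maximality of A. *)
  pose B : set algC := fun z => exists p y, [/\ P p, R y & z = p + y * x].
  have PB z : P z -> B z.
    by move=> Pz; exists z, 0; split=> //; [apply: subring0 | rewrite mul0r addr0].
  have IBB : (I `|` B)%classic = B.
    by apply/funext => z; apply/propext; split=> [[Iz | //] | Bz]; [apply/PB; left | right].
  apply: (maxA B).
    split; first by move=> z Az; apply: PB; right.
    move=> BA; apply: nPx; right; apply: BA; exists 0, 1.
    by split=> //; rewrite add0r mul1r.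
  split; last first.
    by move=> _ [p [y [Pp Ry ->]]] Sz; apply: noS; exists p, y.
  rewrite IBB; split.
  - by move=> _ [p [y [Pp Ry ->]]]; apply: subringD => //; [apply: (PR) | apply: (RM)].
  - exact: PB.
  - move=> _ _ [p [y [Pp Ry ->]]] [p' [y' [Pp' Ry' ->]]].
    exists (p + p'), (y + y'); split; [exact: PD | exact: subringD | ring].
  - move=> r _ Rr [p [y [Pp Ry ->]]].
    exists (r * p), (r * y); split; [exact: PM | exact: RM | ring].
exists P; split=> //; first by move=> x Ix; left.
move=> a b Ra Rb Pab.
have [Pa | nPa] := pselect (P a); first by left.
have [Pb | nPb] := pselect (P b); first by right.
have [p [y [Pp Ry Sa]]] := maxP a Ra nPa.
have [p' [y' [Pp' Ry' Sb]]] := maxP b Rb nPb.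
exfalso; apply: (PS) (SM _ _ Sa Sb).
(* The product of the two elements of S is in S, yet every term of this expansion is in P. *)
have -> : (p + y * a) * (p' + y' * b) =
          (p' + y' * b) * p + ((y * a) * p' + (y * y') * (a * b)) by ring.
apply: (PD); first by apply: (PM) => //; apply: subringD; [|apply: (PR)|apply: (RM)].
by apply: (PD); apply: (PM) => //; apply: (RM).
Qed.

Lemma idealXB R I x y n : is_subring R -> is_ideal R I ->
  R x -> R y -> I (x - y) -> I (x ^+ n - y ^+ n).
Proof.
move=> SR [_ I0 ID IM] Rx Ry Ixy; have [_ RB RM] := SR.
elim: n => [|n IHn]; first by rewrite subrr.
have -> : x ^+ n.+1 - y ^+ n.+1 = x * (x ^+ n - y ^+ n) + y ^+ n * (x - y).
  by rewrite !exprS; ring.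
by apply: (ID); apply: (IM) => //; apply: subringX.
Qed.

Notation Zbar := (ring_of_integers (fun=> True)).

(** P is a maximal ideal disjoint from the complement of q in the ring of integers of M, so its
    contraction is inside q. If x in q were not in P, maximality would give s = p + y x outside q
    with p in P, and an integral equation of y would force a power of s into q. *)
Lemma lying_over M q : is_subfield M ->
  nonzero_prime_ideal (ring_of_integers M) q ->
  exists2 P, nonzero_prime_ideal Zbar P & lies_over M P q.
Proof.
move=> SM Pq; have SR := ring_of_integers_subring SM; have [R1 RB RM] := SR.
have SZ := ring_of_integers_subring is_subfieldT; have [_ ZB ZM] := SZ.
have Iq := prime_is_ideal Pq; have [qR q0 qD qM] := Iq.
have [_ [_ [_ [_ [[x0 [qx0 nz_x0]] [nq1 pr]]]]]] := Pq.
have RZ x : ring_of_integers M x -> Zbar x by case.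
pose S x := ring_of_integers M x /\ ~ q x.
have [||||||P [IP _ PS Ppr Pmax]] := @multiplicative_avoiding_prime Zbar (fun x => x = 0) S.
- by [].
- split=> [x -> ||x y -> ->|r x _ ->] //; rewrite ?addr0 ?mulr0 //.
- by move=> x [/RZ].
- by [].
- move=> x y [Rx nqx] [Ry nqy]; split; first exact: RM.
  by move=> /(pr _ _ Rx Ry)[].
- by move=> _ -> [].
have [PR P0 PD PM] := IP.
have over : lies_over M P q.
  move=> x; split=> [[Px Rx] | qx].
    by apply: contrapT => nqx; apply: (PS) Px _; split.
  have Rx := qR x qx; split=> //; apply: contrapT => nPx.
  have [p [y [Pp [_ Ay] [Rs nqs]]]] := Pmax x (RZ x Rx) nPx.
  move: Rs nqs; set s := p + y * x => Rs nqs.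
  have [f mon_f fy0] : integralOver intr y by apply/Aint_integralOver.
  have [n sz_f] : exists n, size f = n.+1.
    by exists (size f).-1; rewrite prednK // size_poly_gt0 monic_neq0.
  (* The homogenisation of f vanishes at (s : x) modulo P, since y = s / x. *)
  pose T := \sum_(i < n.+1) (f`_i)%:~R * s ^+ i * x ^+ (n - i).
  have Zs := RZ s Rs; have Zx := RZ x Rx.
  have PT : P T.
    (* The subtracted terms add up to x^n f(y) = 0, and s is congruent to y x modulo P. *)
    have -> : T = \sum_(i < n.+1)
        (f`_i)%:~R * x ^+ (n - i) * (s ^+ i - (y * x) ^+ i).
      under [RHS]eq_bigr => i _ do rewrite mulrBr mulrAC.
      rewrite sumrB -[LHS]subr0; congr (_ - _).
      transitivity (x ^+ n * (map_poly intr f).[y]).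
        by rewrite (rootP fy0) mulr0.
      rewrite horner_coef size_map_inj_poly //; last exact: intr_inj.
      rewrite sz_f mulr_sumr; apply: eq_bigr => i _.
      have -> : x ^+ n = x ^+ (n - i) * x ^+ i by rewrite -exprD subnK // -ltnS.
      by rewrite coef_map exprMn /=; ring.
    elim/big_ind: _ => // i _; apply: (PM).
      by apply: (ZM); [apply: (subring_int _ _) | apply: subringX].
    by apply: (idealXB _ SZ IP Zs); rewrite ?addrK //; apply: ZM.
  have RT i : ring_of_integers M ((f`_i)%:~R * s ^+ i * x ^+ (n - i)).
    by apply: (RM); [apply: (RM); [exact: (subring_int _ SR)|]|]; apply: (subringX _ SR).
  (* T does not involve y, so it lies in the ring of integers of M as well as in P. *)
  have qT : q T.
    apply: contrapT => nqT; apply: (PS) PT _; split=> //.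
    by rewrite /T; elim/big_ind: _ => // [|a b]; [apply: (subring0 SR) | apply: (subringD SR)].
  (* The term of index n is s^n; all others are multiples of x, hence in q. *)
  apply: nqs; apply: (@primeX _ _ _ n SR Pq Rs).
  move: qT; rewrite /T big_ord_recr /= subnn mulr1.
  have -> : f`_n = 1 by move/monicP: mon_f; rewrite lead_coefE sz_f.
  rewrite mul1r; set T' := \sum_(i < n) _ => qT.
  rewrite -[X in q X](addKr T').
  apply: (qD) => //; apply: (idealN SR Iq).
  rewrite /T'; elim/big_ind: _ => // i _.
  rewrite -(subnSK (ltn_ord i)) exprSr mulrA.
  apply: qM => //.
  by apply: (RM); [apply: (RM); [exact: (subring_int _ SR)|]|];
    apply: (subringX _ SR).
exists P => //.
do 4!split=> //; split; first by exists x0; split=> //; case: (over x0) => _ /(_ qx0)[].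
by split=> // P1; apply: (PS) P1 _; split.
Qed.

(** * Generated fields *)

Lemma gen_field_subfield S : is_subfield (gen_field S).
Proof.
split; first by move=> F SF _; case: SF.
split; first by move=> F SF _; case: SF => _ [].
split.
  move=> x y Sx Sy F SF SubF; case: (SF) => _ [_ [FD _]].
  by apply: FD; [apply: Sx | apply: Sy].
split.
  by move=> x Sx F SF SubF; case: (SF) => _ [_ [_ [FN _]]]; apply: FN; apply: Sx.
split.
  move=> x y Sx Sy F SF SubF; case: (SF) => _ [_ [_ [_ [FM _]]]].
  by apply: FM; [apply: Sx | apply: Sy].
by move=> x Sx nz_x F SF SubF; case: (SF) => _ [_ [_ [_ [_ FV]]]]; apply: FV => //; apply: Sx.
Qed.

Lemma sub_gen_field (S : algC -> Prop) x : S x -> gen_field S x.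
Proof. by move=> Sx F _; apply. Qed.

(** The generators lie in the image of an abstract number field [Qs]. This image is a subfield, so
    it contains the generated field, and a rational basis of [Qs] spans it. *)
Lemma gen_field_finite_number_field (s : seq algC) (S : algC -> Prop) :
  (forall x, S x -> x \in s) -> number_field (gen_field S).
Proof.
move=> Ss; split; first exact: gen_field_subfield.
have [Qs [QsC [s1 Ds _]]] := num_field_exists s.
pose B := vbasis {:Qs}; exists (\dim {:Qs}), (fun i => QsC B`_i) => x Sx.
have [y ->] : exists y, x = QsC y.
  apply: (Sx (fun x => exists y, x = QsC y)) => [|z /Ss]; last first.
    by rewrite -Ds => /mapP[y _ ->]; exists y.
  split; first by exists 0; rewrite rmorph0.
  split; first by exists 1; rewrite rmorph1.
  split; first by move=> _ _ [a ->] [b ->]; exists (a + b); rewrite rmorphD.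
  split; first by move=> _ [a ->]; exists (- a); rewrite rmorphN.
  split; first by move=> _ _ [a ->] [b ->]; exists (a * b); rewrite rmorphM.
  by move=> _ [a ->] _; exists a^-1; rewrite fmorphV.
exists (fun i => coord B i y); rewrite {1}(coord_vbasis (memvf y)) rmorph_sum.
by apply: eq_bigr => i _; rewrite rmorphZ_num.
Qed.

(** * X and Y through primes of the ring of all algebraic integers *)

(** Primes of the ring of integers of K(g) above p are exchanged with primes of [Zbar] above p by
    contraction in one direction and lying over in the other; poles are preserved. *)
Lemma in_X_Zbar K g p : is_subfield K ->
  in_X K g p <-> nonzero_prime_ideal (ring_of_integers K) p /\
    forall P, nonzero_prime_ideal Zbar P -> lies_over K P p ->
      pole (fun=> True) P g.
Proof.
move=> SK; have SKg : is_subfield (adjoin K g) by apply: gen_field_subfield.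
have KKg x : K x -> adjoin K g x by move=> Kx; apply: sub_gen_field; left.
have Kgg : adjoin K g g by apply: sub_gen_field; right.
split=> -[Pp poleX]; split=> //; [move=> P PP Pover | move=> q Pq qover].
  have Pq := contraction_prime SKg is_subfieldT (fun _ _ => I) PP.
  apply/(pole_contraction SKg is_subfieldT (fun _ _ => I) Kgg PP (fun _ => iff_refl _)).
  apply/(val_neg_pole SKg Kgg Pq); apply: poleX => // x.
  rewrite -Pover; split=> [[[]] // | [Px Kx]]; split=> //; split=> //.
  by case: Kx => /KKg.
apply/(val_neg_pole SKg Kgg Pq).
have [P PP Pover] := lying_over SKg Pq.
apply/(pole_contraction SKg is_subfieldT (fun _ _ => I) Kgg PP Pover).
apply: poleX => // x; rewrite -qover -Pover.
split=> [[Px Kx] | [[]] //]; split=> //; split=> //.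
by case: Kx => /KKg.
Qed.

Lemma in_Y_Zbar K g p : is_subfield K ->
  in_Y K g p <-> nonzero_prime_ideal (ring_of_integers K) p /\
    exists P, [/\ nonzero_prime_ideal Zbar P, lies_over K P p
                & pole (fun=> True) P g].
Proof.
move=> SK; have SKg : is_subfield (adjoin K g) by apply: gen_field_subfield.
have KKg x : K x -> adjoin K g x by move=> Kx; apply: sub_gen_field; left.
have Kgg : adjoin K g g by apply: sub_gen_field; right.
split=> -[Pp [P [PP Pover Pg]]]; split=> //.
  have [Q PQ Qover] := lying_over SKg PP; exists Q; split=> //.
    move=> x; rewrite -Pover -Qover.
    split=> [[Px Kx] | [[]] //]; split=> //; split=> //.
    by case: Kx => /KKg.
  apply/(pole_contraction SKg is_subfieldT (fun _ _ => I) Kgg PQ Qover).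
  exact/(val_neg_pole SKg Kgg PP).
have Pq := contraction_prime SKg is_subfieldT (fun _ _ => I) PP.
exists (fun x => P x /\ ring_of_integers (adjoin K g) x); split=> //.
  move=> x; rewrite -Pover; split=> [[[]] // | [Px Kx]]; split=> //; split=> //.
  by case: Kx => /KKg.
apply/(val_neg_pole SKg Kgg Pq).
exact/(pole_contraction SKg is_subfieldT (fun _ _ => I) Kgg PP (fun _ => iff_refl _)).
Qed.

Definition same_poles (g1 g2 : algC) : Prop :=
  forall P, nonzero_prime_ideal Zbar P ->
    pole (fun=> True) P g1 <-> pole (fun=> True) P g2.

Lemma same_poles_X_eq K g1 g2 : is_subfield K ->
  same_poles g1 g2 -> X_eq K g1 g2.
Proof.
move=> SK eq12 p; rewrite !in_X_Zbar //.
by split=> -[Pp poles]; split=> // P PP Pover; apply/(eq12 P PP); apply: poles.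
Qed.

Lemma same_poles_Y_eq K g1 g2 : is_subfield K ->
  same_poles g1 g2 -> Y_eq K g1 g2.
Proof.
move=> SK eq12 p; rewrite !in_Y_Zbar //.
by split=> -[Pp [P [PP Pover Pg]]]; split=> //; exists P; split=> //; apply/(eq12 P PP).
Qed.

(** As g is in K, having a pole at a prime above p depends on p only, so membership in X detects a
    pole at each single P. *)
Lemma in_X_contraction K g P : is_subfield K -> K g ->
  nonzero_prime_ideal Zbar P ->
  in_X K g (fun x => P x /\ ring_of_integers K x) <-> pole (fun=> True) P g.
Proof.
move=> SK Kg PP; rewrite in_X_Zbar //.
have polesE Q q (PQ : nonzero_prime_ideal Zbar Q) (Qover : lies_over K Q q) :
    pole K q g <-> pole (fun=> True) Q g.
  exact: pole_contraction SK is_subfieldT (fun _ _ => I) Kg PQ Qover.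
split=> [[_ poles] | Pg]; first by apply: poles.
split; first exact: contraction_prime SK is_subfieldT (fun _ _ => I) PP.
move=> Q PQ Qover; apply/(polesE Q _ PQ Qover).
exact/(polesE P _ PP (fun _ => iff_refl _)).
Qed.

Lemma in_Y_contraction K g P : is_subfield K -> K g ->
  nonzero_prime_ideal Zbar P ->
  in_Y K g (fun x => P x /\ ring_of_integers K x) <-> pole (fun=> True) P g.
Proof.
move=> SK Kg PP; rewrite in_Y_Zbar //.
have polesE Q q (PQ : nonzero_prime_ideal Zbar Q) (Qover : lies_over K Q q) :
    pole K q g <-> pole (fun=> True) Q g.
  exact: pole_contraction SK is_subfieldT (fun _ _ => I) Kg PQ Qover.
split=> [[_ [Q [PQ Qover Qg]]] | Pg].
  apply/(polesE P _ PP (fun _ => iff_refl _)).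
  exact/(polesE Q _ PQ Qover).
split; first exact: contraction_prime SK is_subfieldT (fun _ _ => I) PP.
by exists P.
Qed.

(** * Radicals of denominator ideals *)

Lemma denom_ideal_ideal g : is_ideal Zbar (denom_ideal g).
Proof.
split=> [x [Ax _] | | x y [Ax Axg] [Ay Ayg] | r x [_ Ar] [Ax Axg]] //.
- by split; rewrite ?mul0r ?Aint0.
- by split; rewrite ?mulrDl rpredD.
by split; rewrite -?mulrA rpredM.
Qed.

(** Ensures that a prime containing the denominator ideal is nonzero. The witness is the leading
    coefficient of an integer polynomial vanishing at g. *)
Lemma denom_ideal_neq0 g : exists x, denom_ideal g x /\ x != 0.
Proof.
have [p p1 pg0] := root_primitive g.
have nz_p : p != 0 by apply/eqP=> p0; move: p1; rewrite p0 zcontents0.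
exists (lead_coef p)%:~R; split; last by rewrite intr_eq0 lead_coef_eq0.
split; first exact: Aint_int.
rewrite -(lead_coef_map_inj (f := intr)) //; last exact: intr_inj.
apply: lead_coef_mul_Aint pg0.
by apply/polyOverP=> i; rewrite coef_map Aint_int.
Qed.

(** Given the inclusion, a denominator of g1 has a power that is a denominator of g2, so it lies in
    every pole of g2. Conversely, if no power of a is a denominator of g2, Krull's theorem gives a
    pole of g2 avoiding the powers of a; it is a pole of g1, so no power of a is a denominator of
    g1. *)
Lemma sub_radical_poles g1 g2 :
  (forall a, radical (denom_ideal g1) a -> radical (denom_ideal g2) a) <->
  (forall P, nonzero_prime_ideal Zbar P ->
     pole (fun=> True) P g2 -> pole (fun=> True) P g1).
Proof.
have SZ := ring_of_integers_subring is_subfieldT; have [_ _ ZM] := SZ.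
split=> [sub12 P PP Pg s [_ As] [_ Asg] | poles a [Aa [n [n0 [Aan Aang]]]]].
  have [|_ [n [_ [Asn Asng]]]] := sub12 s; first by split=> //; exists 1%N.
  by apply: (primeX (n := n) SZ PP) => //; apply: Pg.
split=> //; apply: contrapT => no_pow.
pose S x := exists n, x = a ^+ n.
have [||||||P [IP DP PS Ppr _]] :=
    @multiplicative_avoiding_prime Zbar (denom_ideal g2) S.
- exact: SZ.
- exact: denom_ideal_ideal.
- by move=> _ [m ->]; split; rewrite ?rpredX.
- by exists 0%N.
- by move=> _ _ [k ->] [l ->]; exists (k + l)%N; rewrite exprD.
(* One more factor a, because [radical] asks for a positive exponent and m may be 0. *)
- move=> x Dx [m Dm]; apply: no_pow; exists m.+1; split=> //.
  have [_ _ _ DM] := denom_ideal_ideal g2.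
  by rewrite exprS -Dm; apply: DM.
have [PR P0 PD PM] := IP.
have PP : nonzero_prime_ideal Zbar P.
  do 4!split=> //; split.
    by have [x [Dx nz_x]] := denom_ideal_neq0 g2; exists x; split=> //; apply: DP.
  by split=> // P1; apply: PS P1 _; exists 0%N.
apply: (PS (a ^+ n)); last by exists n.
apply: (poles P PP); last by split.
  by move=> s [_ As] [_ Asg]; apply: DP; split.
by split.
Qed.

Lemma radical_same_poles g1 g2 :
  (forall a, radical (denom_ideal g1) a <-> radical (denom_ideal g2) a) <->
  same_poles g1 g2.
Proof.
have [rp12 pr12] := sub_radical_poles g1 g2.
have [rp21 pr21] := sub_radical_poles g2 g1.
split=> [eq12 P PP | eq12 a].
  split; first by apply: rp21 => // a; apply: (proj2 (eq12 a)).
  by apply: rp12 => // a; apply: (proj1 (eq12 a)).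
split; first by apply: pr12 => P PP; apply: (proj2 (eq12 P PP)).
by apply: pr21 => P PP; apply: (proj1 (eq12 P PP)).
Qed.

(** * Equivalence of the five conditions *)

Theorem mainTheorem19 (g1 g2 : algC) :
  let K12 := gen_field (fun x => x = g1 \/ x = g2) in
  [/\ X_eq K12 g1 g2 <-> (forall L, number_field L -> X_eq L g1 g2),
      (forall L, number_field L -> X_eq L g1 g2) <->
        (forall a, radical (denom_ideal g1) a <-> radical (denom_ideal g2) a),
      (forall a, radical (denom_ideal g1) a <-> radical (denom_ideal g2) a) <->
        (forall L, number_field L -> Y_eq L g1 g2) &
      (forall L, number_field L -> Y_eq L g1 g2) <-> Y_eq K12 g1 g2].
Proof.
(* With the radical condition turned into [same_poles], each other condition is compared with it;
   those over [K12] are instances of those over all number fields. *)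
move=> K12; rewrite (propext (radical_same_poles g1 g2)).
have NK : number_field K12.
  apply: (@gen_field_finite_number_field [:: g1; g2]) => x.
  by case=> ->; rewrite !inE eqxx ?orbT.
have [SK _] := NK.
have K1 : K12 g1 by apply: sub_gen_field; left.
have K2 : K12 g2 by apply: sub_gen_field; right.
have X12 : X_eq K12 g1 g2 -> same_poles g1 g2.
  by move=> XK P PP; rewrite -(in_X_contraction SK K1 PP) -(in_X_contraction SK K2 PP).
have Y12 : Y_eq K12 g1 g2 -> same_poles g1 g2.
  by move=> YK P PP; rewrite -(in_Y_contraction SK K1 PP) -(in_Y_contraction SK K2 PP).
have allX : same_poles g1 g2 -> forall L, number_field L -> X_eq L g1 g2.
  by move=> eq12 L [SL _]; apply: same_poles_X_eq.
have allY : same_poles g1 g2 -> forall L, number_field L -> Y_eq L g1 g2.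
  by move=> eq12 L [SL _]; apply: same_poles_Y_eq.
by split; split; auto.
Qed.
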